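(* Let $\mathcal{H}$ be a countably generated Hilbert $\mathcal{A}$-module over a (nonzero) unital $C^*$-algebra $\mathcal{A}$. Let $\{f_k\}_{k=1}^{\infty}$ and $\{\tilde f_k\}_{k=1}^{\infty}$ be $(1,\mathcal{K}_1)$- and $(1,\mathcal{K}_2)$-compact-tight frames for $\mathcal{H}$, respectively. If there exists an infinite subset $\sigma$ of $\mathbb{N}=\{1,2,\dots\}$ such that $\{f_k\}_{k\in\sigma}$ and $\{\tilde f_k\}_{k\in\sigma^c}$ are orthonormal bases of $\mathcal{H}$, where $\sigma^c=\mathbb{N}\setminus\sigma$, then $\{f_k\}_{k=1}^{\infty}$ and $\{\tilde f_k\}_{k=1}^{\infty}$ cannot be woven.
   Context: Hilbert $\mathcal{A}$-modules are left modules with an $\mathcal{A}$-valued inner product $\langle\cdot,\cdot\rangle$ that is $\mathcal{A}$-linear in the first variable and satisfies $\langle x,y\rangle=\langle y,x\rangle^*$; the norm is $\|x\|=\|\langle x,x\rangle\|^{1/2}$. Inequalities between elements of $\mathcal{A}$ are in the order of self-adjoint elements of $\mathcal{A}$, and series are understood to converge in norm. A family $\{f_k\}_{k\in\Theta}$ in $\mathcal{H}$ is a frame with lower bound $A>0$ and upper bound $B>0$ if $A\langle f,f\rangle\le\sum_{k\in\Theta}\langle f,f_k\rangle\langle f_k,f\rangle\le B\langle f,f\rangle$ for all $f\in\mathcal{H}$; its frame operator is $Sf=\sum_k\langle f,f_k\rangle f_k$. An orthonormal basis $\{e_k\}_k$ satisfies $\langle e_j,e_k\rangle=\delta_{jk}1_{\mathcal{A}}$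 and $f=\sum_k\langle f,e_k\rangle e_k$ for all $f\in\mathcal{H}$. Compact operators on $\mathcal{H}$ are the elements of the norm closure of the linear span of the operators $f\mapsto\langle f,x\rangle y$, $x,y\in\mathcal{H}$. A frame is $(\xi,\mathcal{K})$-compact-tight if its frame operator is $S=\mathcal{K}+\xi I$ with $\mathcal{K}$ a compact operator, $\xi$ a real scalar and $I$ the identity operator. Two frames $\{f_k\}_{k=1}^\infty$ and $\{\tilde f_k\}_{k=1}^\infty$ are woven if there are universal constants $C,D>0$ such that for every partition $\{\sigma_1,\sigma_2\}$ of $\mathbb{N}$ the family $\{f_k\}_{k\in\sigma_1}\cup\{\tilde f_k\}_{k\in\sigma_2}$ (an indexed family, counted with multiplicity) is a frame for $\mathcal{H}$ with lower and upper bounds $C$ and $D$. *)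

(* Defs.v *)
From HB Require Import structures.
From mathcomp Require Import all_boot all_order all_algebra.
From mathcomp Require Export complex.
From mathcomp Require Export boolp classical_sets functions cardinality reals.
From mathcomp Require Export topology normedtype sequences.

Set Implicit Arguments.
Unset Strict Implicit.
Unset Printing Implicit Defensive.

Import Order.TTheory GRing.Theory Num.Theory.
Import numFieldNormedType.Exports.

Local Open Scope classical_set_scope.
Local Open Scope complex_scope.
Local Open Scope ring_scope.

(** * Convergence in norm

    The structures below carry their norm as a real-valued field: MathComp's
    hierarchy has no join of rings with normed modules, nor of normed modules
    over R[i] with modules over a C*-algebra. *)

Section NormConvergence.
Context {R : realType} {V : zmodType} (nrm : V -> R).

Definition norm_cvg (u : nat -> V) (l : V) : Prop :=
  (fun n => nrm (u n - l)) @ \oo --> (0 : R).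

Definition norm_cauchy (u : nat -> V) : Prop :=
  forall eps : R, 0 < eps -> exists N : nat,
    forall m n : nat, (N <= m)%N -> (N <= n)%N -> nrm (u m - u n) < eps.

Definition norm_complete : Prop :=
  forall u : nat -> V, norm_cauchy u -> exists l : V, norm_cvg u l.

(** The partial sums of u over the indices in Theta, taken in increasing
    order, converge to l. *)
Definition sums_to (Theta : set nat) (u : nat -> V) (l : V) : Prop :=
  norm_cvg (fun n => \sum_(0 <= k < n | k \in Theta) u k) l.

End NormConvergence.

(** * Unital C*-algebras

    An algType has a unit with 1 != 0. In R[i] the norm `|c| is the complex
    number whose real part is the modulus of c. *)

HB.mixin Record isCStarAlgebra (R : realType) A of GRing.Algebra R[i] A := {
  star : A -> A;
  cnorm : A -> R;
  cnormD : forall a b : A, cnorm (a + b) <= cnorm a + cnorm b;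
  cnormZ : forall (c : R[i]) (a : A),
    cnorm (c *: a) = complex.Re `|c| * cnorm a;
  cnorm0_eq0 : forall a : A, cnorm a = 0 -> a = 0;
  cnormM : forall a b : A, cnorm (a * b) <= cnorm a * cnorm b;
  cnorm_complete : norm_complete cnorm;
  starK : involutive star;
  starD : {morph star : a b / a + b};
  starZ : forall (c : R[i]) (a : A), star (c *: a) = c^* *: star a;
  starM : forall a b : A, star (a * b) = star b * star a;
  cnorm_star : forall a : A, cnorm (star a * a) = cnorm a ^+ 2
}.

#[short(type="cstarAlgType")]
HB.structure Definition CStarAlgebra (R : realType) :=
  {A of isCStarAlgebra R A & GRing.Algebra R[i] A}.

Section Order.
Context {R : realType} {A : cstarAlgType R}.
Implicit Types a b : A.

Definition selfadjoint a : Prop := star a = a.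

Definition invertible a : Prop := exists b, b * a = 1 /\ a * b = 1.

Definition spectrum a : set R[i] := [set z | ~ invertible (a - z%:A)].

(** In R[i], 0 <= z means that z is real and nonnegative. *)
Definition positive a : Prop :=
  selfadjoint a /\ spectrum a `<=` [set z | 0 <= z].

Definition cstar_le a b : Prop := positive (b - a).

End Order.

(** * Hilbert modules

    Complex scalars act on a left A-module through c%:A. The axiom hnormD is
    a consequence of the other ones (by the Cauchy-Schwarz inequality); it is
    listed so that hnorm is a norm by definition. *)

HB.mixin Record isHilbertModule (R : realType) (A : cstarAlgType R) H
    of GRing.Lmodule A H := {
  inner : H -> H -> A;
  innerDl : forall x y z : H, inner (x + y) z = inner x z + inner y z;
  innerZl : forall (a : A) (x y : H), inner (a *: x) y = a * inner x y;
  inner_star : forall x y : H, inner x y = star (inner y x);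
  inner_positive : forall x : H, positive (inner x x);
  inner_eq0 : forall x : H, inner x x = 0 -> x = 0;
  hnormD : forall x y : H,
    Num.sqrt (cnorm (inner (x + y) (x + y))) <=
    Num.sqrt (cnorm (inner x x)) + Num.sqrt (cnorm (inner y y));
  hnorm_complete : norm_complete (fun x : H => Num.sqrt (cnorm (inner x x)))
}.

#[short(type="hilbertModType")]
HB.structure Definition HilbertModule (R : realType) (A : cstarAlgType R) :=
  {H of isHilbertModule R A H & GRing.Lmodule A H}.

Notation "'<|' x , y '|>'" := (inner x y) (at level 0, x, y at level 99,
  format "'<|' x ,  y '|>'") : ring_scope.

Section HilbertModuleTheory.
Context {R : realType} {A : cstarAlgType R} {H : hilbertModType A}.
Implicit Types (f g e : nat -> H) (Theta : set nat) (S T K : H -> H).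

Definition hnorm (x : H) : R := Num.sqrt (cnorm <|x, x|>).

Definition module_span (G : set H) : set H :=
  [set x | exists (n : nat) (a : 'I_n -> A) (y : 'I_n -> H),
     (forall i, G (y i)) /\ x = \sum_(i < n) a i *: y i].

Definition is_frame Theta f (lo up : R) : Prop :=
  [/\ 0 < lo, 0 < up &
    forall x : H, exists s : A,
      [/\ sums_to cnorm Theta (fun k => <|x, f k|> * <|f k, x|>) s,
          cstar_le (lo%:C *: <|x, x|>) s &
          cstar_le s (up%:C *: <|x, x|>)]].

Definition is_frame_operator Theta f S : Prop :=
  forall x : H, sums_to hnorm Theta (fun k => <|x, f k|> *: f k) (S x).

Definition orthonormal_basis Theta e : Prop :=
  (forall j k, Theta j -> Theta k -> <|e j, e k|> = (j == k)%:R) /\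
  (forall x : H, sums_to hnorm Theta (fun k => <|x, e k|> *: e k) x).

Definition rank_one (x y : H) : H -> H := fun z => <|z, x|> *: y.

Definition finite_rank T : Prop :=
  exists (n : nat) (c : 'I_n -> R[i]) (x y : 'I_n -> H),
    forall z, T z = \sum_(i < n) (c i)%:A *: rank_one (x i) (y i) z.

(** The last inequality says that the operator norm of K - T is at most eps. *)
Definition compact_operator K : Prop :=
  forall eps : R, 0 < eps ->
    exists T, finite_rank T /\ forall z, hnorm (K z - T z) <= eps * hnorm z.

Definition compact_tight_frame (xi : R) K f : Prop :=
  [/\ exists lo up, is_frame setT f lo up,
      compact_operator K &
      is_frame_operator setT f (fun x => K x + (xi%:C)%:A *: x)].

(** As sigma1 and sigma2 partition the index set, the union of the two
    subfamilies, counted with multiplicity, is again indexed by nat. *)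
Definition woven f g : Prop :=
  exists C D : R, [/\ 0 < C, 0 < D &
    forall sigma1 sigma2 : set nat,
      sigma1 `|` sigma2 = setT -> sigma1 `&` sigma2 = set0 ->
      is_frame setT (fun k => if k \in sigma1 then f k else g k) C D].

End HilbertModuleTheory.

Definition countably_generated {R : realType} {A : cstarAlgType R}
    (H : hilbertModType A) : Prop :=
  exists G : set H, countable G /\
    forall (x : H) (eps : R), 0 < eps ->
      exists2 y, module_span G y & hnorm (x - y) < eps.

(* Main.v *)
From mathcomp Require Import all_boot all_order all_algebra.
From mathcomp Require Import ring lra.
Require Import Defs.
From mathcomp Require Import derive.

(** In the weaving that takes f off sigma and ft on sigma, exactly the two
    orthonormal bases are removed, so its frame operator is the compact operator
    K1 + K2. A compact operator tends to 0 in norm along the orthonormal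
    sequence (f k) with k in sigma, and so does the frame sum of f k, which the
    lower frame bound keeps above C%:A.

    That a >= C%:A forces |a| >= C rests on the spectrum of a selfadjoint a
    being nonempty in any disc of radius r > |a|. If a - z were invertible for
    all |z| <= r, the Cayley transform V = (a + ir)(a - ir)^-1 would be unitary,
    with 1 - u V bounded below uniformly in |u| = 1. Hence the sums
    D u = \sum_(k < L) (u V)^k with u^L = 1 would be bounded independently of L,
    whereas (D u)^* (D u) has mean L over the L-th roots of unity u. *)

Set Implicit Arguments.
Unset Strict Implicit.
Unset Printing Implicit Defensive.

Import Order.TTheory GRing.Theory Num.Theory.
Import numFieldNormedType.Exports.

Local Open Scope classical_set_scope.
Local Open Scope complex_scope.
Local Open Scope ring_scope.

(** * Roots of unity of two-power order *)

Lemma prim_root_exp2 (C : numClosedFieldType) (n : nat) :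
  exists z : C, (2 ^ n.+1).-primitive_root z.
Proof.
(* A [2 ^ n]-th root of -1 has order dividing [2 ^ n.+1] but not [2 ^ n], so its order is exactly
   [2 ^ n.+1]. *)
have zN1 : ((2 ^ n).-root (-1) : C) ^+ (2 ^ n) = -1.
  by rewrite rootCK // expn_gt0.
set z := _.-root _ in zN1; exists z.
have z1 : z ^+ (2 ^ n.+1) = 1 by rewrite expnSr exprM zN1 sqrrN expr1n.
have [m zm mdvd] := prim_order_exists (expn_gt0 2 n.+1) z1.
have [//|k kn def_m] := dvdn_pfactor m n.+1 _ mdvd.
move: kn; rewrite leq_eqVlt => /predU1P[<-|kn]; first by rewrite -def_m.
have : z ^+ (2 ^ n) == 1 by rewrite -(prim_order_dvd zm) def_m dvdn_exp2l.
by rewrite zN1 eqNr oner_eq0.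
Qed.

(** * The real-valued modulus on [R[i]] *)

Section ComplexModulus.
Context {R : realType}.
Implicit Types (c d : R[i]) (t : R).

Definition modulus c : R := complex.Re `|c|.

Lemma modulusE c : (modulus c)%:C = `|c|.
Proof. by rewrite RRe_real // normr_real. Qed.

Lemma modulus_ge0 c : 0 <= modulus c.
Proof. by rewrite -lecR modulusE normr_ge0. Qed.

Lemma modulusM c d : modulus (c * d) = modulus c * modulus d.
Proof. by apply: complexI; rewrite rmorphM /= !modulusE normrM. Qed.

Lemma modulusD c d : modulus (c + d) <= modulus c + modulus d.
Proof. by rewrite -lecR rmorphD /= !modulusE ler_normD. Qed.

Lemma modulusV c : modulus c^-1 = (modulus c)^-1.
Proof. by apply: complexI; rewrite fmorphV /= !modulusE normfV. Qed.

Lemma modulusN c : modulus (- c) = modulus c.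
Proof. by rewrite /modulus normrN. Qed.

Lemma modulus_real t : modulus t%:C = `|t|.
Proof. by rewrite /modulus normc_def /= expr0n addr0 sqrtr_sqr. Qed.

Lemma modulus_i : modulus 'i%C = 1.
Proof. by rewrite /modulus normc_def /= expr0n expr1n add0r sqrtr1. Qed.

Lemma modulus_nat n : modulus n%:R = n%:R.
Proof. by rewrite -(rmorph_nat (real_complex R)) modulus_real normr_nat. Qed.

Lemma modulus_unity_root c n : (0 < n)%N -> c ^+ n = 1 -> modulus c = 1.
Proof.
move=> n0 cn; apply: complexI; rewrite modulusE; apply/eqP.
by rewrite -(@pexpr_eq1 _ _ n) -?normrX ?cn ?normr1 ?normr_ge0.
Qed.

Lemma conj_imaginary t : ('i%C * t%:C)^* = - ('i%C * t%:C).
Proof.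
by apply/eqP; rewrite eq_complex /=; apply/andP; split; apply/eqP; ring.
Qed.

End ComplexModulus.

(** * Norm and involution of a C*-algebra *)

Section CstarNorm.
Context {R : realType} {A : cstarAlgType R}.
Implicit Types (a b d : A) (c : R[i]).

Lemma cnormZE c a : cnorm (c *: a) = modulus c * cnorm a.
Proof. exact: cnormZ. Qed.

Lemma star0 : star 0 = 0 :> A.
Proof. by apply: (addrI (star 0)); rewrite -starD !addr0. Qed.

Lemma star1 : star 1 = 1 :> A.
Proof. by rewrite -[LHS]mulr1 -{2}(starK 1) -starM mulr1 starK. Qed.

Lemma starN a : star (- a) = - star a.
Proof. by apply: (addrI (star a)); rewrite -starD !subrr star0. Qed.

Lemma star_sum n (F : 'I_n -> A) :
  star (\sum_(k < n) F k) = \sum_(k < n) star (F k).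
Proof. exact: (big_morph _ (@starD _ _) star0). Qed.

Lemma cnorm0 : cnorm (0 : A) = 0.
Proof. by rewrite -(scale0r 1) cnormZE modulus_real normr0 mul0r. Qed.

Lemma cnormN a : cnorm (- a) = cnorm a.
Proof. by rewrite -scaleN1r cnormZE modulusN (modulus_nat 1) mul1r. Qed.

Lemma cnorm_ge0 a : 0 <= cnorm a.
Proof. by have := cnormD a (- a); rewrite subrr cnorm0 cnormN; lra. Qed.

Lemma cnormB a b : cnorm (a - b) <= cnorm a + cnorm b.
Proof. by rewrite -(cnormN b) cnormD. Qed.

Lemma cnorm1 : cnorm (1 : A) = 1.
Proof.
have n1 : cnorm (1 : A) != 0.
  by apply/eqP => /cnorm0_eq0/eqP; rewrite oner_eq0.
have := cnorm_star (1 : A); rewrite star1 mulr1 expr2 => h.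
by apply: (mulIf n1); rewrite -h mul1r.
Qed.

Lemma cnorm_sum n (F : 'I_n -> A) :
  cnorm (\sum_(k < n) F k) <= \sum_(k < n) cnorm (F k).
Proof.
elim/big_ind2: _ => // [|a x b y ha hb]; first by rewrite cnorm0.
exact: le_trans (cnormD _ _) (lerD ha hb).
Qed.

(** The C*-identity and submultiplicativity give |b|^2 <= |star b| |b|, hence |b| <= |star b|; this
    is applied to [a] and to [star a]. *)
Lemma cnorm_starE a : cnorm (star a) = cnorm a.
Proof.
have le_star b : cnorm b <= cnorm (star b).
  have [b0|bN0] := eqVneq (cnorm b) 0; first by rewrite b0 cnorm_ge0.
  rewrite -(ler_pM2r (_ : 0 < cnorm b)) ?lt0r ?bN0 ?cnorm_ge0 //.
  by rewrite -expr2 -cnorm_star cnormM.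
by apply/le_anti; rewrite -{2}(starK a) !le_star.
Qed.

End CstarNorm.

(** * The spectrum of a selfadjoint element via the Cayley transform *)

Section SelfadjointSpectrum.
Context {R : realType} {A : cstarAlgType R}.
Implicit Types (a d w : A) (r t : R).

Lemma invertible_bounded_below a r : 0 <= r ->
    {in `[- r, r]%R, forall t, invertible (a - t%:C%:A)} ->
  exists2 m : R, 0 < m &
    {in `[- r, r]%R, forall t d, m * cnorm d <= cnorm ((a - t%:C%:A) * d)}.
Proof.
move=> r0 ainv.
have [w wP] : {w : R -> A & forall t, t \in `[- r, r]%R ->
    w t * (a - t%:C%:A) = 1 /\ (a - t%:C%:A) * w t = 1}.
  apply: (boolp.choice (P := fun (t : R) (w : A) => t \in `[- r, r]%R ->
    w * (a - t%:C%:A) = 1 /\ (a - t%:C%:A) * w = 1)) => t.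
  (* Outside the interval the condition is vacuous and 0 is a dummy value. *)
  have [/ainv[b bP]|] := boolP (t \in `[- r, r]%R); last by exists 0.
  by exists b.
have w_gt0 t : t \in `[- r, r]%R -> 0 < cnorm (w t).
  move=> /wP[wt _]; rewrite lt0r cnorm_ge0 andbT; apply/eqP => /cnorm0_eq0 w0.
  by move/eqP: wt; rewrite w0 mul0r eq_sym oner_eq0.
(* The resolvent identity makes |(a - t)^-1|^-1 Lipschitz in t, so it attains a
   positive minimum. *)
have w_lip s t : s \in `[- r, r]%R -> t \in `[- r, r]%R ->
    (cnorm (w s))^-1 - (cnorm (w t))^-1 <= `|s - t|.
  move=> sr tr; have [ws _] := wP s sr; have [_ wt] := wP t tr.
  have : w t = w s + (t - s)%:C *: (w s * w t).
    have -> : (t - s)%:C *: (w s * w t) =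
        w s * ((a - s%:C%:A) - (a - t%:C%:A)) * w t.
      rewrite [X in _ * X * _](_ : _ = (t - s)%:C *: 1); last first.
        by rewrite opprD opprK addrACA subrr add0r addrC rmorphB scalerBl.
      by rewrite -scalerAr mulr1 -scalerAl.
    by rewrite mulrBr mulrBl ws mul1r -mulrA wt mulr1 addrC subrK.
  move=> wE; have : cnorm (w t) <=
      cnorm (w s) + `|s - t| * (cnorm (w s) * cnorm (w t)).
    rewrite {1}wE (le_trans (cnormD _ _)) // lerD2l cnormZE modulus_real distrC.
    by rewrite ler_wpM2l ?cnormM.
  have vs := w_gt0 s sr; have vt := w_gt0 t tr; move=> le_w.
  rewrite -(ler_pM2r (mulr_gt0 vs vt)) mulrBl.
  rewrite mulKf ?gt_eqF // [cnorm (w s) * _]mulrC mulKf ?gt_eqF //.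
  rewrite lerBlDl [cnorm (w t) * _]mulrC; lra.
have [||c cr cmin] := @EVT_min R (fun t => (cnorm (w t))^-1) (- r) r.
- lra.
- apply/subspace_continuousP => x xr; apply/cvgrPdist_lt => e e0.
  near=> t.
  have tr : t \in `[- r, r]%R by near: t; exact: withinT.
  have xtr : `|x - t| < e.
    by near: t; apply: cvg_within; exact: nbhsx_ballx.
  rewrite (le_lt_trans _ xtr) // ler_norml.
  have h1 := w_lip _ _ xr tr; have := w_lip _ _ tr xr; rewrite distrC => h2.
  by apply/andP; split; [rewrite lerNl opprB|].
exists (cnorm (w c))^-1; first by rewrite invr_gt0 w_gt0.
move=> t tr d; apply: le_trans (_ : (cnorm (w t))^-1 * cnorm d <= _).
  by rewrite ler_wpM2r ?cnorm_ge0 ?cmin.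
rewrite ler_pdivrMl ?w_gt0 //; have [wt _] := wP t tr.
by rewrite (le_trans _ (cnormM _ _)) // mulrA wt mul1r.
Unshelve. all: by end_near.
Qed.

Lemma isometry_expX (V : A) n : star V * V = 1 -> star (V ^+ n) * V ^+ n = 1.
Proof.
move=> VV; elim: n => [|n IHn]; first by rewrite expr0 star1 mulr1.
by rewrite exprSr starM mulrA -(mulrA (star V)) IHn mulr1.
Qed.

Lemma cnorm_isometry (V : A) : star V * V = 1 -> cnorm V = 1.
Proof.
move=> /(congr1 cnorm); rewrite cnorm_star cnorm1 => /eqP.
by rewrite sqrp_eq1 ?cnorm_ge0 // => /eqP.
Qed.

(** Expanding the product leaves, for each pair (k, l), a sum of j-th powers of a root of unity. It
    vanishes for k != l, and each of the [L] diagonal pairs contributes [L] because the powers of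
    [V] are isometries. *)
Lemma isometry_sum_unity_roots (V : A) (L : nat) (z : R[i]) :
    star V * V = 1 -> L.-primitive_root z ->
  \sum_(j < L) star (\sum_(k < L) (z ^+ j *: V) ^+ k) *
               (\sum_(k < L) (z ^+ j *: V) ^+ k) = (L * L)%:R.
Proof.
move=> VV zL.
have L0 := prim_order_gt0 zL.
have zz : z^* * z = 1.
  rewrite -normCKC -modulusE.
  by rewrite (modulus_unity_root L0 (prim_expr_order zL)) expr1n.
transitivity (\sum_(k < L) \sum_(l < L) \sum_(j < L)
    ((z^* ^+ k * z ^+ l) ^+ j) *: (star (V ^+ k) * V ^+ l)).
  under [RHS]eq_bigr do rewrite exchange_big.
  rewrite exchange_big /=; apply: eq_bigr => j _.
  rewrite star_sum mulr_suml; apply: eq_bigr => k _.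
  rewrite mulr_sumr; apply: eq_bigr => l _.
  rewrite !(exprZn _ V) starZ -scalerAl -scalerAr scalerA; congr (_ *: _).
  by rewrite !rmorphXn exprMn -!exprM !(mulnC j).
transitivity (\sum_(k < L) (L%:R : A)); last first.
  by rewrite sumr_const card_ord natrM mulr_natr.
apply: eq_bigr => k _; rewrite (bigD1 k) //= [X in _ + X]big1 ?addr0.
  rewrite -exprMn zz expr1n isometry_expX //.
  under eq_bigr do rewrite expr1n scale1r.
  by rewrite sumr_const card_ord.
(* Off the diagonal [u] is an [L]-th root of unity, and primitivity of [z] makes it different from
   1; so the factorization of [u ^+ L - 1] kills the geometric sum. *)
move=> l lk; rewrite -scaler_suml; set u := _ * _.
suff -> : \sum_(j < L) u ^+ j = 0 by rewrite scale0r.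
have uL : u ^+ L = 1.
  rewrite exprMn !(exprAC _ _ L) (prim_expr_order zL) expr1n mulr1.
  have := congr1 (fun x => x ^+ L) zz.
  by rewrite exprMn (prim_expr_order zL) mulr1 expr1n => ->; rewrite expr1n.
have /eqP := subrX1 u L; rewrite uL subrr eq_sym mulf_eq0 => /orP[|/eqP//].
rewrite subr_eq0 => /eqP u1; case/negP: lk.
have : z ^+ l == z ^+ k.
  by rewrite -[z ^+ k]mulr1 -u1 /u mulrA -exprMn [z * _]mulrC zz expr1n mul1r.
by rewrite (eq_prim_root_expr zL) !modn_small // => /eqP /val_inj ->.
Qed.

(** A mean is at most the largest of its terms. Powers of two suffice as lengths, since they are
    unbounded. *)
Lemma isometry_power_sums (V : A) (n : nat) (B : R) : star V * V = 1 ->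
    (forall w : R[i], w ^+ (2 ^ n.+1) = 1 ->
      cnorm (\sum_(k < 2 ^ n.+1) (w *: V) ^+ k) <= B) ->
  (2 ^ n.+1)%:R <= B ^+ 2.
Proof.
set L := (2 ^ n.+1)%N => VV VB; have [z zL] := prim_root_exp2 R[i] n.
have L0 : (0 < L%:R :> R) by rewrite ltr0n expn_gt0.
rewrite -(ler_pM2l L0).
have -> : L%:R * L%:R = cnorm ((L * L)%:R : A).
  have <- : (L * L)%:R *: (1 : A) = (L * L)%:R by rewrite scaler_nat.
  by rewrite cnormZE cnorm1 mulr1 modulus_nat natrM.
rewrite -(isometry_sum_unity_roots VV zL) (le_trans (cnorm_sum _)) //.
have B0 : 0 <= B by apply: le_trans (cnorm_ge0 _) (VB 1 _); rewrite expr1n.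
apply: le_trans (_ : \sum_(j < L) B ^+ 2 <= _).
  apply: ler_sum => j _; rewrite cnorm_star lerXn2r ?nnegrE ?cnorm_ge0 //.
  by apply: VB; rewrite exprAC (prim_expr_order zL) expr1n.
by rewrite sumr_const card_ord mulr_natl.
Qed.

(** For u^(n+1) = 1 the geometric sum D satisfies (1 - u V) D = 1 - V^(n+1), of norm at most 2.
    Since 1 - u V = ((1 - u) a - (1 + u) q) w, a lower bound on the first factor, uniform in u,
    bounds w D and hence D. *)
Lemma cayley_power_sums_bounded a r (q : R[i]) w : cnorm a < r ->
    (forall z : R[i], modulus z <= r -> invertible (a - z%:A)) ->
    q^* = - q -> modulus q = r -> (a - q%:A) * w = 1 ->
    let V := (a + q%:A) * w in
    star V * V = 1 ->
  exists B, forall n (u : R[i]), u ^+ n.+1 = 1 ->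
    cnorm (\sum_(k < n.+1) (u *: V) ^+ k) <= B.
Proof.
move=> ar ainv qJ qr wr V VV.
have a0 := cnorm_ge0 a.
have r0 : 0 < r by lra.
have [||m m0 abelow] := @invertible_bounded_below a r; first lra.
  by move=> t; rewrite in_itv /= -ler_norml -modulus_real => /ainv.
(* One constant for each of the two cases of [below]. *)
pose mu := Num.min m (r - cnorm a).
have mu0 : 0 < mu by rewrite lt_min m0 subr_gt0.
(* This is (1 - u V) (a - q) d. It is bounded below by |q| > |a| when
   |1 - u| <= |1 + u|; otherwise it is (1 - u) (a - z) d, where
   z = (1 + u) q / (1 - u) is real because |u| = 1 and q is imaginary. *)
have below (u : R[i]) d : modulus u = 1 ->
    mu * cnorm d <= cnorm (((1 - u) *: a - ((1 + u) * q)%:A) * d).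
  move=> u1; have d0 := cnorm_ge0 d.
  have two : 2 <= modulus (1 + u) + modulus (1 - u).
    rewrite -(modulus_nat 2) (le_trans _ (modulusD _ _)) //.
    by rewrite addrACA subrr addr0.
  have [le1|gt1] := leP (modulus (1 - u)) (modulus (1 + u)).
    have h : cnorm (((1 + u) * q) *: d) <= cnorm ((1 - u) *: (a * d)) +
        cnorm (((1 - u) *: a - ((1 + u) * q)%:A) * d).
      have -> : ((1 + u) * q) *: d = (1 - u) *: (a * d) -
          ((1 - u) *: a - ((1 + u) * q)%:A) * d.
        by rewrite mulrBl -!scalerAl mul1r opprB [RHS]addrC subrK.
      exact: cnormB.
    move: h; rewrite !cnormZE modulusM qr => h.
    have hE : mu * cnorm d <= (r - cnorm a) * cnorm d.
      by rewrite ler_wpM2r // ge_min lexx orbT.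
    (* By [h], the target norm is at least |1 + u| r |d| - |1 - u| |a d|. Now [h2] replaces |a d| by
       |a| |d|, [h3] replaces |1 - u| by |1 + u|, and [h1] drops the factor |1 + u|. *)
    have h1 : 0 <= (modulus (1 + u) - 1) * ((r - cnorm a) * cnorm d).
      by rewrite !mulr_ge0 // subr_ge0 ?(ltW ar) //; lra.
    have h2 : 0 <= modulus (1 - u) * (cnorm a * cnorm d - cnorm (a * d)).
      by rewrite mulr_ge0 ?modulus_ge0 // subr_ge0 cnormM.
    have h3 : 0 <= (modulus (1 + u) - modulus (1 - u)) * (cnorm a * cnorm d).
      by rewrite !mulr_ge0 // subr_ge0.
    lra.
  have p1 : 1 <= modulus (1 - u) by lra.
  have uN1 : 1 - u != 0.
    apply/eqP => u0; move: p1; rewrite u0 -(rmorph0 (real_complex R)).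
    by rewrite modulus_real normr0; lra.
  pose z := (1 + u) * q / (1 - u).
  have zr : z = (complex.Re z)%:C.
    rewrite RRe_real // CrealE /z.
    rewrite !(rmorphM, fmorphV, rmorphB, rmorphD, rmorph1) /=.
    have uu : u^* * u = 1 by rewrite -normCKC -modulusE u1 expr1n.
    have u0 : u != 0.
      by apply: contra_eq_neq uu => ->; rewrite mulr0 eq_sym oner_eq0.
    have -> : u^* = u^-1 by rewrite -[LHS](mulfK u0) uu mul1r.
    rewrite qJ; apply/eqP; field.
    by rewrite uN1 u0 -opprB oppr_eq0.
  have hz : complex.Re z \in `[- r, r]%R.
    rewrite in_itv /= -ler_norml -modulus_real -zr /z modulusM modulusM qr.
    rewrite modulusV mulrAC ger_pMl // ler_pdivrMr ?mul1r ?(ltW gt1) //.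
    lra.
  have -> : (1 - u) *: a - ((1 + u) * q)%:A = (1 - u) *: (a - z%:A).
    by rewrite scalerBr scalerA /z [(1 - u) * _]mulrC divfK.
  rewrite -scalerAl cnormZE.
  have h1 : mu * cnorm d <= m * cnorm d by rewrite ler_wpM2r // ge_min lexx.
  have := abelow _ hz d; rewrite -zr => h2.
  apply: (le_trans h1); apply: (le_trans h2).
  by rewrite ler_peMl ?cnorm_ge0.
(* The first factor bounds a - q, the second bounds w D, and D = (a - q) (w D). *)
exists ((cnorm a + r) * (2 / mu)) => n u un.
have u1 : modulus u = 1 by apply: modulus_unity_root un.
set D := \sum_(k < _) _.
have ED : ((1 - u) *: a - ((1 + u) * q)%:A) * (w * D) = 1 - V ^+ n.+1.
  have -> : (1 - u) *: a - ((1 + u) * q)%:A = (a - q%:A) - u *: (a + q%:A).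
    rewrite scalerBl scale1r scalerDr scalerA mulrDl mul1r scalerDl !opprD.
    by rewrite !addrA; congr (_ - _); rewrite addrAC.
  rewrite mulrA mulrBl wr -scalerAl -/V -[in RHS](scale1r (V ^+ _)) -un -exprZn.
  by rewrite -opprB -[RHS]opprB subrX1 mulNr.
have := below u (w * D) u1; rewrite ED => hD.
have {hD} : mu * cnorm (w * D) <= 2.
  rewrite (le_trans hD) // (le_trans (cnormB _ _)) // cnorm1.
  by rewrite (cnorm_isometry (V := V ^+ _)) // isometry_expX.
rewrite mulrC -ler_pdivlMr // => hD.
have -> : D = (a - q%:A) * (w * D) by rewrite mulrA wr mul1r.
rewrite (le_trans (cnormM _ _)) // ler_pM ?cnorm_ge0 //.
by rewrite (le_trans (cnormB _ _)) // cnormZE cnorm1 mulr1 qr.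
Qed.

Lemma selfadjoint_spectrum a r : selfadjoint a -> cnorm a < r ->
  exists2 z : R[i], modulus z <= r & spectrum a z.
Proof.
move=> sa ar; apply: contrapT => noz.
have ainv (z : R[i]) : modulus z <= r -> invertible (a - z%:A).
  by move=> zr; apply: contrapT => zN; apply: noz; exists z.
have r0 : 0 < r by have := cnorm_ge0 a; lra.
pose q : R[i] := 'i%C * r%:C.
have qr : modulus q = r.
  by rewrite modulusM modulus_i mul1r modulus_real ger0_norm ?ltW.
have [w [wl wr]] : invertible (a - q%:A) by apply: ainv; rewrite qr.
have qJ : q^* = - q by exact: conj_imaginary.
have sp : star (a + q%:A) = a - q%:A.
  by rewrite starD starZ star1 sa qJ scaleNr.
have sm : star (a - q%:A) = a + q%:A by rewrite -sp starK.
pose V := (a + q%:A) * w.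
(* As [a] is selfadjoint and [q] imaginary, [star] exchanges a + q and a - q, which commute. *)
have VV : star V * V = 1.
  rewrite starM sp mulrA -(mulrA (star w)).
  have -> : (a - q%:A) * (a + q%:A) = (a + q%:A) * (a - q%:A).
    have aq : a * q%:A = q%:A * a by rewrite -scalerAl -scalerAr mul1r mulr1.
    by rewrite !(mulrDl, mulrDr, mulrN, mulNr) aq !addrA addrK subrK.
  by rewrite -sm mulrA -starM wr star1 mul1r wr.
have [B VB] := cayley_power_sums_bounded ar ainv qJ qr wr VV.
(* This exponent makes the length of the sums exceed B^2. The length is then rewritten as a
   successor to fit [VB]. *)
have := @isometry_power_sums V (Num.bound (B ^+ 2)) B VV.
have -> : (2 ^ (Num.bound (B ^+ 2)).+1)%N = (2 ^ (Num.bound (B ^+ 2)).+1).-1.+1.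
  by rewrite prednK // expn_gt0.
move=> /(_ (VB _)); rewrite prednK ?expn_gt0 // leNgt => /negP; apply.
rewrite (lt_trans (archi_boundP (sqr_ge0 B))) // ltr_nat.
by rewrite (ltn_trans (ltnSn _)) // ltn_expl.
Qed.

(** If |a| < t, some spectral value z of [a] has modulus below t; but z - t lies in the spectrum of
    the positive element a - t, which forces z >= t. *)
Lemma cstar_le_scalar_norm t a : cstar_le t%:C%:A a -> t <= cnorm a.
Proof.
move=> [sa pos]; rewrite leNgt; apply/negP => at_.
have sa' : selfadjoint a.
  move: sa; rewrite /selfadjoint starD starN starZ star1.
  by rewrite conj_Creal ?complex_real // => /addIr.
(* The midpoint is a radius strictly between |a| and t. *)
have [|z zr az] := @selfadjoint_spectrum a ((cnorm a + t) / 2) sa'; first lra.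
have : spectrum (a - t%:C%:A) (z - t%:C).
  by rewrite /spectrum /= scalerBl opprB addrA subrK.
move=> /pos /=; rewrite subr_ge0 => tz.
suff : t <= modulus z by lra.
rewrite -lecR modulusE ger0_norm // (le_trans _ tz) // ler0c.
by rewrite (le_trans (cnorm_ge0 a)) // ltW.
Qed.

End SelfadjointSpectrum.

(** * Inner product and norm of a Hilbert module *)

Section HilbertNorm.
Context {R : realType} {A : cstarAlgType R} {H : hilbertModType A}.
Implicit Types (x y z : H) (a : A) (t : R) (Theta : set nat).

Lemma innerDr x y z : <|x, y + z|> = <|x, y|> + <|x, z|>.
Proof. by rewrite inner_star innerDl starD -!inner_star. Qed.

Lemma innerZr a x y : <|x, a *: y|> = <|x, y|> * star a.
Proof. by rewrite inner_star innerZl starM -inner_star. Qed.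

Lemma inner0l x : <|0, x|> = 0.
Proof. by rewrite -(scale0r 0) innerZl mul0r. Qed.

Lemma innerNl x y : <|- x, y|> = - <|x, y|>.
Proof. by rewrite -scaleN1r innerZl mulN1r. Qed.

Lemma innerNr x y : <|x, - y|> = - <|x, y|>.
Proof. by rewrite -scaleN1r innerZr starN star1 mulrN1. Qed.

Lemma inner_suml (I : Type) (r : seq I) (P : pred I) (F : I -> H) x :
  <|\sum_(i <- r | P i) F i, x|> = \sum_(i <- r | P i) <|F i, x|>.
Proof.
exact: (big_morph (fun y => <|y, x|>) (fun y z => innerDl y z x) (inner0l x)).
Qed.

Lemma hnorm_ge0 x : 0 <= hnorm x.
Proof. exact: sqrtr_ge0. Qed.

Lemma sqr_hnorm x : hnorm x ^+ 2 = cnorm <|x, x|>.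
Proof. by rewrite sqr_sqrtr ?cnorm_ge0. Qed.

Lemma hnorm_unit x : <|x, x|> = 1 -> hnorm x = 1.
Proof. by rewrite /hnorm => ->; rewrite cnorm1 sqrtr1. Qed.

Lemma hnormZ_unit a x : <|x, x|> = 1 -> hnorm (a *: x) = cnorm a.
Proof.
move=> x1; rewrite /hnorm innerZl innerZr x1 mul1r -{1}(starK a) cnorm_star.
by rewrite sqrtr_sqr ger0_norm ?cnorm_ge0 // cnorm_starE.
Qed.

Lemma hnorm_eq0 x : hnorm x = 0 -> x = 0.
Proof.
by move=> x0; apply/inner_eq0/cnorm0_eq0; rewrite -sqr_hnorm x0 expr0n.
Qed.

Lemma hnorm0 : hnorm (0 : H) = 0.
Proof. by rewrite /hnorm inner0l cnorm0 sqrtr0. Qed.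

Lemma ler_hnormD x y : hnorm (x + y) <= hnorm x + hnorm y.
Proof. exact: hnormD. Qed.

Lemma hnormN x : hnorm (- x) = hnorm x.
Proof. by rewrite /hnorm innerNl innerNr opprK. Qed.

Lemma ler_hnormB x y : hnorm (x - y) <= hnorm x + hnorm y.
Proof. by rewrite -(hnormN y) ler_hnormD. Qed.

Lemma ler_hnorm_sum (I : finType) (F : I -> H) :
  hnorm (\sum_i F i) <= \sum_i hnorm (F i).
Proof.
elim/big_ind2: _ => // [|x s y t hx hy]; first by rewrite hnorm0.
exact: le_trans (ler_hnormD _ _) (lerD hx hy).
Qed.

Lemma ler_hnormZ a x : hnorm (a *: x) <= cnorm a * hnorm x.
Proof.
rewrite -(@ler_pXn2r _ 2) ?nnegrE ?mulr_ge0 ?hnorm_ge0 ?cnorm_ge0 //.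
rewrite exprMn !sqr_hnorm innerZl innerZr mulrA (le_trans (cnormM _ _)) //.
by rewrite cnorm_starE mulrC expr2 -mulrA ler_wpM2l ?cnorm_ge0 ?cnormM.
Qed.

Lemma inner_polarization_real x y :
  <|x + y, x + y|> - <|x - y, x - y|> = (<|x, y|> + <|y, x|>) *+ 2.
Proof.
rewrite !(innerDl, innerDr, innerNl, innerNr).
move: <|x, x|> <|x, y|> <|y, x|> <|y, y|> => a b c d.
have -> : a + c + (b + d) = (a + d) + (b + c).
  by rewrite [b + d]addrC addrACA [c + b]addrC.
have -> : a - c - (b - d) = (a + d) - (b + c).
  by rewrite opprB [b + c]addrC opprD addrACA.
by rewrite opprB [a + d + _]addrC -addrA [a + d + _]addrC subrK mulr2n.
Qed.

Lemma inner_polarization x y : let iy := ('i%C)%:A *: y in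
  <|x, y|> *+ 4 = <|x + y, x + y|> - <|x - y, x - y|> +
    'i%C *: (<|x + iy, x + iy|> - <|x - iy, x - iy|>).
Proof.
rewrite /= !inner_polarization_real innerZl innerZr starZ star1.
rewrite -!scalerAl -!scalerAr mul1r mulr1.
have -> : ('i%C : R[i])^* = - 'i%C.
  by apply/eqP; rewrite eq_complex /= oppr0 !eqxx.
rewrite -scalerMnr scalerDr scaleNr scalerN !scalerA -expr2 sqr_i !scaleN1r.
by rewrite opprK -mulrnDl addrACA subrr addr0 -mulr2n -mulrnA.
Qed.

(** Each of the four squares in the polarization identity is bounded by the right-hand side, and the
    factor 4 cancels. *)
Lemma cnorm_inner_le_sqr x y : cnorm <|x, y|> <= (hnorm x + hnorm y) ^+ 2.
Proof.
set iy := ('i%C)%:A *: y.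
have iyn : hnorm iy <= hnorm y.
  by rewrite (le_trans (ler_hnormZ _ _)) // cnormZE cnorm1 modulus_i !mul1r.
have le_sqr z : hnorm z <= hnorm x + hnorm y ->
    cnorm <|z, z|> <= (hnorm x + hnorm y) ^+ 2.
  by move=> zxy; rewrite -sqr_hnorm lerXn2r ?nnegrE ?addr_ge0 ?hnorm_ge0.
have xiy : hnorm x + hnorm iy <= hnorm x + hnorm y by rewrite lerD2l.
have h1 := le_sqr _ (ler_hnormD x y); have h2 := le_sqr _ (ler_hnormB x y).
have h3 := le_sqr _ (le_trans (ler_hnormD x iy) xiy).
have h4 := le_sqr _ (le_trans (ler_hnormB x iy) xiy).
have : cnorm (<|x, y|> *+ 4) = 4 * cnorm <|x, y|>.
  by rewrite -scaler_nat cnormZE modulus_nat.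
rewrite inner_polarization -/iy => h.
have := cnormD (<|x + y, x + y|> - <|x - y, x - y|>)
  ('i%C *: (<|x + iy, x + iy|> - <|x - iy, x - iy|>)).
rewrite cnormZE modulus_i mul1r h.
have := cnormB <|x + y, x + y|> <|x - y, x - y|>.
have := cnormB <|x + iy, x + iy|> <|x - iy, x - iy|>.
lra.
Qed.

(* Polarization costs a factor 4 over the Cauchy-Schwarz inequality, but needs
   no order theory of the algebra. *)
Lemma cnorm_inner_le x y : cnorm <|x, y|> <= 4 * (hnorm x * hnorm y).
Proof.
have [/hnorm_eq0 ->|x0] := eqVneq (hnorm x) 0.
  by rewrite inner0l cnorm0 hnorm0 mul0r mulr0.
have [/hnorm_eq0 ->|y0] := eqVneq (hnorm y) 0.
  by rewrite inner_star inner0l star0 cnorm0 hnorm0 mulr0 mulr0.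
have xP : 0 < hnorm x by rewrite lt0r x0 hnorm_ge0.
have yP : 0 < hnorm y by rewrite lt0r y0 hnorm_ge0.
(* For normalized vectors the quadratic bound is at most 4; scaling back makes it bilinear in the
   norms. *)
have unit z : 0 < hnorm z -> hnorm ((hnorm z)^-1%:C%:A *: z) <= 1.
  move=> z0; rewrite (le_trans (ler_hnormZ _ _)) // cnormZE modulus_real cnorm1.
  by rewrite mulr1 gtr0_norm ?invr_gt0 // mulVf ?gt_eqF.
suff : cnorm <|x, y|> <= hnorm y * (hnorm x * 4).
  by rewrite [hnorm x * 4]mulrC mulrCA [hnorm y * _]mulrC.
set bound := hnorm y * _.
have : cnorm <|(hnorm x)^-1%:C%:A *: x, (hnorm y)^-1%:C%:A *: y|> <= 4.
  apply: le_trans (cnorm_inner_le_sqr _ _) _.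
  rewrite -[leRHS](_ : 2 ^+ 2 = _) ?lerXn2r ?nnegrE ?addr_ge0 ?hnorm_ge0 //.
    by have := unit _ xP; have := unit _ yP; lra.
  by ring.
rewrite innerZl innerZr starZ star1 conj_Creal ?complex_real //.
rewrite -!scalerAl -!scalerAr mul1r mulr1 !cnormZE !modulus_real.
rewrite !gtr0_norm ?invr_gt0 // ler_pdivrMl // ler_pdivrMl //.
Qed.
End HilbertNorm.

(** * Norm-convergent series and decay along orthonormal bases *)

Section SumsTo.
Context {R : realType} {A : cstarAlgType R} {H : hilbertModType A}.
Implicit Types (x y z : H) (u v : nat -> H) (Theta : set nat) (K : H -> H).

Lemma norm_cvg_near (V : zmodType) (nrm : V -> R) (w : nat -> V) l e :
  norm_cvg nrm w l -> 0 < e -> \forall n \near \oo, nrm (w n - l) < e.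
Proof.
move=> /cvgrPdist_lt wl e0; near=> n.
have : `|0 - nrm (w n - l)| < e by near: n; exact: wl.
by rewrite sub0r normrN; apply: le_lt_trans (ler_norm _).
Unshelve. all: by end_near.
Qed.

Lemma hnorm_cvg u l :
  (forall e, 0 < e -> \forall n \near \oo, hnorm (u n - l) < e) ->
  norm_cvg (@hnorm R A H) u l.
Proof.
move=> ul; apply/cvgrPdist_lt => e e0; near=> n.
rewrite sub0r normrN ger0_norm ?hnorm_ge0 //; near: n; exact: ul.
Unshelve. all: by end_near.
Qed.

Lemma hnorm_cvgD u v l m : norm_cvg (@hnorm R A H) u l ->
  norm_cvg (@hnorm R A H) v m ->
  norm_cvg (@hnorm R A H) (fun n => u n + v n) (l + m).
Proof.
move=> ul vm; apply: hnorm_cvg => e e0; near=> n.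
rewrite opprD addrACA (le_lt_trans (ler_hnormD _ _)) // (splitr e) ltrD //.
  by near: n; apply: (norm_cvg_near ul); rewrite divr_gt0.
by near: n; apply: (norm_cvg_near vm); rewrite divr_gt0.
Unshelve. all: by end_near.
Qed.

Lemma hnorm_cvgN u l : norm_cvg (@hnorm R A H) u l ->
  norm_cvg (@hnorm R A H) (fun n => - u n) (- l).
Proof.
move=> ul; apply: hnorm_cvg => e e0; near=> n.
rewrite -opprD hnormN; near: n; exact: norm_cvg_near ul e0.
Unshelve. all: by end_near.
Qed.

Lemma partial_sum_setC Theta u n :
  \sum_(0 <= k < n | k \in setT) u k =
  \sum_(0 <= k < n | k \in Theta) u k + \sum_(0 <= k < n | k \in ~` Theta) u k.
Proof.
rewrite (bigID (fun k => k \in Theta)) /=; congr (_ + _); apply: eq_bigl => k.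
  by rewrite in_setT.
by rewrite in_setT in_setC.
Qed.

Lemma sums_to_setC Theta u l m : sums_to (@hnorm R A H) setT u l ->
  sums_to hnorm Theta u m -> sums_to hnorm (~` Theta) u (l - m).
Proof.
move=> ul um; rewrite /sums_to [X in norm_cvg _ X](_ : _ = fun n =>
  \sum_(0 <= k < n | k \in setT) u k + - \sum_(0 <= k < n | k \in Theta) u k).
  exact: hnorm_cvgD ul (hnorm_cvgN um).
by apply/funext => n; rewrite (partial_sum_setC Theta) addrAC subrr add0r.
Qed.

Lemma sums_to_union Theta u v l m : sums_to (@hnorm R A H) Theta u l ->
  sums_to hnorm (~` Theta) v m ->
  sums_to hnorm setT (fun k => if k \in Theta then u k else v k) (l + m).
Proof.
move=> ul vm; rewrite /sums_to [X in norm_cvg _ X](_ : _ = fun n =>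
  \sum_(0 <= k < n | k \in Theta) u k + \sum_(0 <= k < n | k \in ~` Theta) v k).
  exact: hnorm_cvgD ul vm.
apply/funext => n; rewrite (partial_sum_setC Theta); congr (_ + _).
  by apply: eq_bigr => k ->.
by apply: eq_bigr => k; rewrite in_setC => /negPf ->.
Qed.

(** The term is the difference of two consecutive partial sums, both eventually within e / 2 of
    [l]. *)
Lemma sums_to_term_near Theta u l (e : R) :
    sums_to (@hnorm R A H) Theta u l -> 0 < e ->
  \forall n \near \oo, Theta n -> hnorm (u n) < e.
Proof.
move=> ul e0; have e20 : 0 < e / 2 by rewrite divr_gt0.
have [N _ NP] := norm_cvg_near ul e20.
exists N => // n /= Nn nT.
have sumS : \sum_(0 <= k < n.+1 | k \in Theta) u k =
    \sum_(0 <= k < n | k \in Theta) u k + u n.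
  by rewrite big_mkcond big_nat_recr //= -big_mkcond mem_set.
have := NP n.+1 (leqW Nn); have := NP n Nn; rewrite /= sumS.
set q := \sum_(0 <= k < n | _) _ => h1 h2.
have := ler_hnormB (q + u n - l) (q - l).
by rewrite opprB addrA subrK addrAC subrr add0r; lra.
Qed.

(** Partial sums of the frame sum are the inner products with [x] of partial sums of the frame
    operator series, so the bound [cnorm_inner_le] passes to the limit. *)
Lemma cnorm_frame_sum_le Theta (g : nat -> H) x y s :
    sums_to hnorm Theta (fun k => <|x, g k|> *: g k) y ->
    sums_to cnorm Theta (fun k => <|x, g k|> * <|g k, x|>) s ->
  cnorm s <= 4 * (hnorm y * hnorm x).
Proof.
move=> gy gs; apply/ler_addgt0Pr => e e0.
have x0 := hnorm_ge0 x; have x1 : 0 < hnorm x + 1 by lra.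
(* Chosen so that 4 d |x| <= e / 2; adding 1 avoids a zero denominator. *)
pose d := e / 8 / (hnorm x + 1).
have d0 : 0 < d by rewrite !divr_gt0.
near \oo => n.
have hs : cnorm (\sum_(0 <= k < n | k \in Theta) <|x, g k|> * <|g k, x|> - s) <
    e / 2.
  by near: n; apply: (norm_cvg_near gs); rewrite divr_gt0.
have hy : hnorm (\sum_(0 <= k < n | k \in Theta) <|x, g k|> *: g k - y) < d.
  by near: n; apply: (norm_cvg_near gy).
have sumE : \sum_(0 <= k < n | k \in Theta) <|x, g k|> * <|g k, x|> =
    <|\sum_(0 <= k < n | k \in Theta) <|x, g k|> *: g k, x|>.
  by rewrite inner_suml; apply: eq_bigr => k _; rewrite innerZl.
move: hs hy; rewrite sumE; set q := \sum_(0 <= k < n | _) _ => hs hy.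
have := cnormB <|q, x|> (<|q, x|> - s); rewrite opprB addrC subrK => h1.
have := ler_hnormD (q - y) y; rewrite subrK => h2.
have h3 := cnorm_inner_le q x.
have h4 : (d + hnorm y - hnorm q) * hnorm x >= 0 by rewrite mulr_ge0 //; lra.
have h5 : d * (hnorm x + 1) = e / 8 by rewrite divfK // gt_eqF.
lra.
Unshelve. all: by end_near.
Qed.

(** Since [e k] is a unit vector, the coefficient has the norm of the k-th term in the convergent
    expansion of [x]. *)
Lemma inner_onb_near Theta e x eps : orthonormal_basis Theta e -> 0 < eps ->
  \forall k \near \oo, Theta k -> cnorm <|e k, x|> < eps.
Proof.
move=> [ee esum] eps0; near=> k => kT.
rewrite inner_star cnorm_starE -(hnormZ_unit _ (_ : <|e k, e k|> = 1)).
  by move: kT; near: k; apply: sums_to_term_near (esum x) eps0.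
by rewrite ee // eqxx.
Unshelve. all: by end_near.
Qed.

Lemma finite_rank_onb_near Theta e (T : H -> H) eps : finite_rank T ->
    orthonormal_basis Theta e -> 0 < eps ->
  \forall k \near \oo, Theta k -> hnorm (T (e k)) < eps.
Proof.
move=> [n [c [x [y Txy]]]] eonb eps0.
pose B := \sum_(i < n) modulus (c i) * hnorm (y i).
have B0 : 0 <= B.
  by apply: sumr_ge0 => i _; rewrite mulr_ge0 ?modulus_ge0 ?hnorm_ge0.
pose d := eps / (B + 1).
have d0 : 0 < d by rewrite divr_gt0 //; lra.
have dB : B * d < eps.
  have : d * (B + 1) = eps by rewrite divfK // gt_eqF //; lra.
  lra.
near=> k => kT; apply: le_lt_trans dB.
rewrite Txy (le_trans (ler_hnorm_sum _)) // mulr_suml ler_sum // => i _.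
rewrite (le_trans (ler_hnormZ _ _)) // cnormZE cnorm1 mulr1 -mulrA.
rewrite ler_wpM2l ?modulus_ge0 // (le_trans (ler_hnormZ _ _)) // mulrC.
rewrite ler_wpM2l ?hnorm_ge0 // ltW //.
(* Only finitely many vectors [x i] occur, so one threshold on k serves them all. *)
move: i kT; near: k; apply: filter_forall => i; exact: inner_onb_near eonb d0.
Unshelve. all: by end_near.
Qed.

(** A finite-rank approximation in operator norm is uniformly good on the unit vectors [e k], which
    reduces the claim to finite rank. *)
Lemma compact_onb_near Theta e K eps : compact_operator K ->
    orthonormal_basis Theta e -> 0 < eps ->
  \forall k \near \oo, Theta k -> hnorm (K (e k)) < eps.
Proof.
move=> Kc eonb eps0; have eps20 : 0 < eps / 2 by rewrite divr_gt0.
have [T [Tfin KT]] := Kc _ eps20; near=> k => kT.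
have ek : hnorm (e k) = 1 by rewrite hnorm_unit // eonb.1 // eqxx.
have := KT (e k); rewrite ek mulr1 => h1.
have h2 : hnorm (T (e k)) < eps / 2.
  by move: kT; near: k; apply: finite_rank_onb_near Tfin eonb eps20.
have := ler_hnormD (K (e k) - T (e k)) (T (e k)); rewrite subrK; lra.
Unshelve. all: by end_near.
Qed.

End SumsTo.

(** * The weaving without a lower frame bound *)

Theorem theorem3p8 (R : realType) (A : cstarAlgType R) (H : hilbertModType A)
  (f ft : nat -> H) (K1 K2 : H -> H) (sigma : set nat) :
  countably_generated H ->
  compact_tight_frame 1 K1 f ->
  compact_tight_frame 1 K2 ft ->
  infinite_set sigma ->
  orthonormal_basis sigma f ->
  orthonormal_basis (~` sigma) ft ->
  ~ woven f ft.
Proof.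
move=> _ [_ K1c Sf] [_ K2c Sft] sigma_inf onf onft [C [D [C0 _ wov]]].
have [_ _ frame] := wov (~` sigma) sigma (setUCl _) (setICl _).
(* Two compact terms and the factor 4 of [cnorm_frame_sum_le] give 4 (C / 16 + C / 16) = C / 2,
   below C. *)
have C16 : 0 < C / 16 by rewrite divr_gt0.
have [N1 _ small1] := compact_onb_near K1c onf C16.
have [N2 _ small2] := compact_onb_near K2c onf C16.
(* Otherwise [sigma] would lie below the larger threshold and be finite. *)
have [k [ks N1k N2k]] : exists k, [/\ sigma k, (N1 <= k)%N & (N2 <= k)%N].
  apply: contrapT => noK; apply: sigma_inf.
  apply: (@sub_finite_set _ _ `I_(maxn N1 N2)) (finite_II _) => k ks /=.
  rewrite ltnNge geq_max; apply/negP => /andP[N1k N2k]; apply: noK; by exists k.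
set x := f k.
have xx : <|x, x|> = 1 by rewrite onf.1 // eqxx.
have [s [gs low _]] := frame x.
pose g j := if j \in ~` sigma then f j else ft j.
(* The full series of [f] sums to K1 x + x and its part over [sigma] to x, so the part off [sigma]
   sums to K1 x; likewise the part of [ft] over [sigma] sums to K2 x. *)
have K1x := sums_to_setC (Sf x) (onf.2 x).
have K2x := sums_to_setC (Sft x) (onft.2 x).
rewrite !rmorph1 !scale1r !addrK in K1x K2x.
have := sums_to_union K1x K2x; set h := fun k => _ => gy.
have {}gy : sums_to hnorm setT (fun k => <|x, g k|> *: g k) (K1 x + K2 x).
  rewrite (_ : (fun k => _) = h) //; apply/funext => j.
  by rewrite /h /g; case: ifP.
have := cnorm_frame_sum_le (g := g) gy gs; rewrite (hnorm_unit xx) mulr1.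
move=> s_le.
(* As [x] is a unit vector, the lower frame bound gives C <= |s|, against |s| < C / 2. *)
rewrite xx in low; have := cstar_le_scalar_norm low.
have := ler_hnormD (K1 x) (K2 x).
have := small1 _ N1k ks; have := small2 _ N2k ks; rewrite -/x; lra.
Qed.
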